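(* Let $H = H^\top\in\mathbb{R}^{N\times N}$ with cospectral vertices $u,v$, and let $\{\phi^\nu\}_{\nu=1}^N$ be an orthonormal eigenbasis of $H$ chosen such that, for each eigenvalue $\lambda$, at most one basis eigenvector for $\lambda$ satisfies $\phi_u = \phi_v \neq 0$, at most one satisfies $\phi_u = -\phi_v\neq 0$, and all remaining basis eigenvectors for $\lambda$ satisfy $\phi_u = \phi_v = 0$. Let $p\in\{+1,-1\}$, let $\mathbb{M}\subseteq\{1,\dots,N\}$ and let $\gamma = (\gamma_m)_{m\in\mathbb{M}}$ be a tuple of real numbers. Then every basis eigenvector $\phi$ with $\phi_u = p\,\phi_v \neq 0$ satisfies $$\sum_{m\in\mathbb{M}}\gamma_m\phi_m = 0$$ if and only if $\mathbb{M}^{-p}_\gamma$ is a walk multiplet of $H$ relative to $u,v$ with parity $-p$ and weight tuple $\gamma$.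
   Context: A real symmetric matrix $H$ is identified with an undirected weighted graph on vertices $1,\dots,N$. Two vertices $u,v$ are cospectral in $H$ if $[H^k]_{u,u} = [H^k]_{v,v}$ for all integers $k\ge0$; in this case an orthonormal eigenbasis with the stated property exists (obtained by projecting $e_u\pm e_v$ onto each eigenspace). Given a vertex subset $\mathbb{M}$, a real tuple $\gamma = (\gamma_m)_{m\in\mathbb{M}}$ and $q\in\{+1,-1\}$, $\mathbb{M}$ is a walk multiplet $\mathbb{M}^q_\gamma$ of $H$ relative to $u,v$ with parity $q$ if $\sum_{m\in\mathbb{M}}\gamma_m[H^k]_{u,m} = q\sum_{m\in\mathbb{M}}\gamma_m[H^k]_{v,m}$ for all $k\in\{0,\dots,N-1\}$ (equivalently for all integers $k\ge0$). *)

(* Defs.v *)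
From HB Require Import structures.
From mathcomp Require Import all_boot all_order all_algebra.
From mathcomp Require Import reals.

Set Implicit Arguments.
Unset Strict Implicit.
Unset Printing Implicit Defensive.

Import Order.TTheory GRing.Theory Num.Theory.
Local Open Scope ring_scope.

Definition cospectral (R : realType) (N : nat) (H : 'M[R]_N) (u v : 'I_N) :
    Prop :=
  forall k : nat, (H ^+ k) u u = (H ^+ k) v v.

(* The tuple (gamma_m)_{m in M} is a function on all vertices of which only
   the values on M are used. *)
Definition walk_multiplet (R : realType) (N : nat) (H : 'M[R]_N) (u v : 'I_N)
    (M : {set 'I_N}) (gamma : 'I_N -> R) (q : R) : Prop :=
  forall k : nat, (k < N)%N ->
    \sum_(m in M) gamma m * (H ^+ k) u m =
    q * \sum_(m in M) gamma m * (H ^+ k) v m.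

(* mathcomp's eigenspace is about row vectors; here vectors are columns. *)
Definition eigenvector (R : realType) (N : nat) (H : 'M[R]_N) (lambda : R)
    (x : 'cV[R]_N) : Prop :=
  x != 0 /\ H *m x = lambda *: x.

Definition orthonormal_eigenbasis (R : realType) (N : nat) (H : 'M[R]_N)
    (phi : 'I_N -> 'cV[R]_N) : Prop :=
  [/\ basis_of fullv [seq phi nu | nu : 'I_N],
      forall mu nu : 'I_N, (phi mu)^T *m phi nu = (mu == nu)%:R%:M
    & forall nu : 'I_N, exists lambda : R, eigenvector H lambda (phi nu)].

Definition local_parity (R : realType) (N : nat) (u v : 'I_N) (p : R)
    (x : 'cV[R]_N) : Prop :=
  x u 0 = p * x v 0 /\ x u 0 <> 0.

Definition parity_adapted (R : realType) (N : nat) (H : 'M[R]_N)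
    (u v : 'I_N) (phi : 'I_N -> 'cV[R]_N) : Prop :=
  forall lambda : R,
    [/\ forall mu nu : 'I_N,
          eigenvector H lambda (phi mu) -> eigenvector H lambda (phi nu) ->
          local_parity u v 1 (phi mu) -> local_parity u v 1 (phi nu) ->
          mu = nu,
        forall mu nu : 'I_N,
          eigenvector H lambda (phi mu) -> eigenvector H lambda (phi nu) ->
          local_parity u v (-1) (phi mu) -> local_parity u v (-1) (phi nu) ->
          mu = nu
      & forall nu : 'I_N, eigenvector H lambda (phi nu) ->
          [\/ local_parity u v 1 (phi nu),
              local_parity u v (-1) (phi nu)
            | phi nu u 0 = 0 /\ phi nu v 0 = 0]].

(* Main.v *)
(** By the spectral decomposition, writing [S_nu] for the [gamma]-weighted sum
    of [phi nu] over [M] and [lam nu] for its eigenvalue,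
      [sum_m gamma_m [H^k]_(u,m) + p sum_m gamma_m [H^k]_(v,m)
       = sum_nu lam_nu^k (phi_nu(u) + p phi_nu(v)) S_nu].
    The factor [phi_nu(u) + p phi_nu(v)] is [2 phi_nu(u)] when [phi nu] has
    local parity [p] and vanishes otherwise, so if all the relevant [S_nu]
    vanish then so do these power sums.  Conversely, the eigenvectors of local
    parity [p] have distinct eigenvalues, so pairing the power sums with the
    coefficients of a polynomial of degree less than [N] which vanishes at all
    the other eigenvalues isolates each [S_nu]. *)
Require Import Defs.
From HB Require Import structures.
From mathcomp Require Import all_boot all_order all_algebra.
From mathcomp Require Import reals ring.

Set Implicit Arguments.
Unset Strict Implicit.
Unset Printing Implicit Defensive.

Import Order.TTheory GRing.Theory Num.Theory.
Local Open Scope ring_scope.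

(** The values [lam j] may repeat: an index sharing the value [lam i] is removed by its zero
    coefficient, every other one by a root of [f]. *)
Lemma power_sums_eq0 (F : fieldType) (N : nat) (c lam : 'I_N -> F) (i : 'I_N) :
  (forall k, (k < N)%N -> \sum_j lam j ^+ k * c j = 0) ->
  (forall j, j != i -> lam j = lam i -> c j = 0) ->
  c i = 0.
Proof.
move=> sum0 c0.
pose A := [pred j | lam j != lam i].
pose f : {poly F} := \prod_(j in A) ('X - (lam j)%:P).
(* The size of [f] is [#|A| + 1], and [A] misses [i]. *)
have size_f : (size f <= N)%N.
  rewrite /f -big_enum size_prod_XsubC -cardE -[leqRHS](card_ord N).
  apply/proper_card/properP; split; first exact/subset_predT.
  by exists i; rewrite ?inE ?eqxx.
have fi : f.[lam i] != 0.
  rewrite /f horner_prod; apply/prodf_neq0 => j.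
  by rewrite inE hornerXsubC subr_eq0 eq_sym.
have : \sum_j f.[lam j] * c j = 0.
  under eq_bigr => j _ do rewrite (horner_coef_wide _ size_f) mulr_suml.
  rewrite exchange_big big1 //= => k _.
  under eq_bigr => j _ do rewrite -mulrA.
  by rewrite -mulr_sumr sum0 ?mulr0.
rewrite (bigD1 i) //= big1 ?addr0 => [/eqP|j ji].
  by rewrite mulf_eq0 (negPf fi) => /eqP.
have [/c0-> //|ne] := eqVneq (lam j) (lam i); first by rewrite mulr0.
by rewrite /f horner_prod (bigD1 j) //= hornerXsubC subrr !mul0r.
Qed.

Lemma mulmx_exp_eigenvector (R : comNzRingType) (N : nat) (H : 'M[R]_N)
    (lam : R) (x : 'cV[R]_N) (k : nat) :
  H *m x = lam *: x -> (H ^+ k) *m x = lam ^+ k *: x.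
Proof.
move=> Hx; elim: k => [|k IHk]; first by rewrite !expr0 mul1mx scale1r.
by rewrite exprSr -[(_ * H)]/(_ *m H) -mulmxA Hx -scalemxAr IHk scalerA exprS.
Qed.

(** The square matrix [P] with columns [phi nu] has [P^T P = 1], hence [P P^T = 1] and
    [H^k = (H^k P) P^T], where column [nu] of [H^k P] is [lam nu ^+ k *: phi nu]. *)
Lemma orthonormal_spectral_decomposition (R : comUnitRingType) (N : nat)
    (H : 'M[R]_N) (phi : 'I_N -> 'cV[R]_N) (lam : 'I_N -> R) (k : nat)
    (i j : 'I_N) :
  (forall mu nu, (phi mu)^T *m phi nu = (mu == nu)%:R%:M) ->
  (forall nu, H *m phi nu = lam nu *: phi nu) ->
  (H ^+ k) i j = \sum_nu lam nu ^+ k * (phi nu i 0 * phi nu j 0).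
Proof.
move=> ortho eig; pose P := \matrix_(a, nu) phi nu a 0.
have PtP : P^T *m P = 1%:M.
  apply/matrixP => mu nu; rewrite !mxE.
  have /matrixP/(_ 0 0) := ortho mu nu; rewrite !mxE eqxx mulr1n => <-.
  by apply: eq_bigr => a _; rewrite !mxE.
rewrite -[H ^+ k]mulmx1 -(mulmx1C PtP) mulmxA mxE.
apply: eq_bigr => nu _; rewrite !mxE.
have /matrixP/(_ i 0) := mulmx_exp_eigenvector k (eig nu).
rewrite !mxE mulrA => <-; congr (_ * _).
by apply: eq_bigr => a _; rewrite !mxE.
Qed.

Theorem theorem4 (R : realType) (N : nat) (H : 'M[R]_N) (u v : 'I_N)
    (phi : 'I_N -> 'cV[R]_N) (p : R) (M : {set 'I_N}) (gamma : 'I_N -> R)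
    (Hsym : H^T = H)
    (Hcosp : cospectral H u v)
    (Hbasis : orthonormal_eigenbasis H phi)
    (Hphi : parity_adapted H u v phi)
    (Hp : p = 1 \/ p = -1) :
  (forall nu : 'I_N, local_parity u v p (phi nu) ->
     \sum_(m in M) gamma m * phi nu m 0 = 0)
  <-> walk_multiplet H u v M gamma (- p).
Proof.
case: Hbasis => _ ortho /fin_all_exists[lam eig].
pose S nu := \sum_(m in M) gamma m * phi nu m 0.
pose c nu := (phi nu u 0 + p * phi nu v 0) * S nu.
have walkE k w : \sum_(m in M) gamma m * (H ^+ k) w m =
    \sum_nu lam nu ^+ k * (phi nu w 0 * S nu).
  under eq_bigr => m _ do rewrite
    (orthonormal_spectral_decomposition _ _ _ ortho (fun nu => (eig nu).2))
    mulr_sumr.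
  rewrite exchange_big; apply: eq_bigr => nu _ /=.
  by rewrite /S !mulr_sumr; apply: eq_bigr => m _; ring.
have multipletE : walk_multiplet H u v M gamma (- p) <->
    forall k, (k < N)%N -> \sum_nu lam nu ^+ k * c nu = 0.
  have sumE k : \sum_nu lam nu ^+ k * c nu =
      \sum_(m in M) gamma m * (H ^+ k) u m
      - (- p) * \sum_(m in M) gamma m * (H ^+ k) v m.
    rewrite !walkE mulr_sumr -sumrB; apply: eq_bigr => nu _.
    by rewrite /c; ring.
  split=> sum0 k /sum0 E; first by rewrite sumE E subrr.
  by apply/eqP; rewrite -subr_eq0 -sumE E.
have parity_or_c0 nu : local_parity u v p (phi nu) \/ c nu = 0.
  rewrite /c; have [_ _ /(_ nu (eig nu))] := Hphi (lam nu).
  case: Hp => -> [par|par|[-> ->]]; first [by left | right];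
    try case: par => -> _; ring.
have parity_inj mu nu : local_parity u v p (phi mu) ->
    local_parity u v p (phi nu) -> lam mu = lam nu -> mu = nu.
  (* Uniqueness holds within one eigenvalue, so [phi mu] is first viewed as an eigenvector for
     [lam nu]. *)
  move=> pmu pnu e; have [inj1 injN1 _] := Hphi (lam nu).
  have emu := eig mu; rewrite e in emu.
  by case: Hp pmu pnu => -> pmu pnu; [apply: inj1 | apply: injN1].
split=> [S0 | /multipletE sum0 nu pnu].
  apply/multipletE => k _; apply: big1 => nu _.
  case: (parity_or_c0 nu) => [/S0 Snu|->]; last by rewrite mulr0.
  by rewrite /c /S Snu !mulr0.
have : c nu = 0.
  apply: (power_sums_eq0 sum0) => mu ne e.
  case: (parity_or_c0 mu) => // pmu.
  by rewrite (parity_inj mu nu) ?eqxx in ne.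
case: pnu => Eu Nu.
(* Here [c nu] is twice the nonzero [phi nu u 0] times [S nu]. *)
rewrite /c -Eu -mulr2n => /eqP.
by rewrite mulf_eq0 mulrn_eq0 => /orP[/eqP|/eqP].
Qed.
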